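(* Let $M_1, M_2$ be complex manifolds that are hyperbolic in the sense of Kobayashi, and let $f\colon M_1\to M_2$ be a holomorphic map. Suppose $f$ is injective on free homotopy classes of closed curves in the sense that, if $\gamma(t)$ is a closed curve in $M_1$ not freely homotopic to a constant, then $f(\gamma(t))$ is not freely homotopic to a constant in $M_2$. Then $$\ell_1(M_2)\le \ell_1(M_1).$$
   Context: A (connected) complex manifold is hyperbolic in the sense of Kobayashi if its Kobayashi pseudodistance is an actual distance function; it is then regarded as a metric space with the Kobayashi distance. For a metric space $(X,\rho)$ and a continuous curve $\alpha\colon[a,b]\to X$, the length is $L(\alpha)=\sup \sum_{k=1}^N\rho(\alpha(t_{k-1}),\alpha(t_k))$, the supremum being over all partitions $a=t_0<\dots<t_N=b$; $\alpha$ is rectifiable if $L(\alpha)<\infty$. The $\ell_1$-invariant is $\ell_1(X)=\inf\{L(\alpha)\colon \alpha$ a rectifiable loop in $X$ not freely homotopic to a constant loop$\}$, with $\inf\varnothing=+\infty$. *)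

(* Defs.v *)
From HB Require Import structures.
From mathcomp Require Import all_boot all_order all_algebra.
From mathcomp Require Import all_classical all_reals all_analysis.
From mathcomp Require Import complex.
Set Implicit Arguments.
Unset Strict Implicit.
Unset Printing Implicit Defensive.
Import Order.TTheory GRing.Theory Num.Theory numFieldNormedType.Exports.

Local Open Scope classical_set_scope.
Local Open Scope ring_scope.
Local Open Scope complex_scope.

(* Complex manifolds modelled on C^n.  Differentiability is taken in normed
   modules over R[i], so it is complex (Frechet) differentiability; holding at
   every point of an open set, it means holomorphy.                           *)

(* Not a plain notation: canonical structure inference finds the topology of
   matrices over R[i] only through the normed module structure.               *)
Definition Cn (R : realType) (n : nat) : normedModType R[i] := 'rV[R[i]]_n.

(* [cmap] and [cinv] are total; only their values on [cdom] and on
   [cmap @` cdom] matter.                                                     *)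
Record chart (R : realType) (M : topologicalType) (n : nat) := Chart {
  cdom : set M;
  cmap : M -> Cn R n;
  cinv : Cn R n -> M;
  cdom_open : open cdom;
  cmap_open : open (cmap @` cdom);
  cmapK : {in cdom, cancel cmap cinv};
  cmap_continuous : {in cdom, continuous cmap};
  cinv_continuous : {in cmap @` cdom, continuous cinv} }.

(* The atlas need not be maximal.  A connected manifold has a constant
   dimension, whence the single [cm_dim].                                     *)
Record complexManifold (R : realType) := ComplexManifold {
  cm_top :> topologicalType;
  cm_dim : nat;
  cm_hausdorff : hausdorff_space cm_top;
  cm_second_countable : @second_countable cm_top;
  cm_connected : connected [set: cm_top];
  cm_atlas : set (chart R cm_top cm_dim);
  cm_cover : forall p : cm_top, exists2 c, cm_atlas c & cdom c p;
  cm_compatible : forall c c', cm_atlas c -> cm_atlas c' ->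
    forall p, cdom c p -> cdom c' p ->
      differentiable (cmap c' \o cinv c) (cmap c p) }.

Definition holomorphic (R : realType) (M1 M2 : complexManifold R)
    (f : M1 -> M2) : Prop :=
  continuous f /\
  forall p c1 c2, cm_atlas c1 -> cm_atlas c2 -> cdom c1 p -> cdom c2 (f p) ->
    differentiable (cmap c2 \o f \o cinv c1) (cmap c1 p).

(* The open unit disc of C. *)
Definition disc (R : realType) : set R[i]^o := [set z | `|z| < 1].

(* Holomorphic maps from the unit disc to M, represented by functions on C whose
   values outside of the disc are irrelevant.                                 *)
Definition holomorphic_disc (R : realType) (M : complexManifold R)
    (f : R[i]^o -> M) : Prop :=
  forall z, disc z ->
    {for z, continuous f} /\
    forall c, cm_atlas c -> cdom c (f z) -> differentiable (cmap c \o f) z.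

(* The Poincare distance of 4 dz dzbar / (1 - |z|^2)^2, of curvature -1. *)
Definition poincare_dist (R : realType) (a b : R[i]) : R :=
  let t := Normc.normc ((a - b) / (1 - a^* * b)) in ln ((1 + t) / (1 - t)).

(* A chain of holomorphic discs from p to q: each link (f, a, b) goes from f a
   to f b.                                                                    *)
Fixpoint disc_chain (R : realType) (M : complexManifold R) (p q : M)
    (s : seq ((R[i]^o -> M) * R[i] * R[i])) : Prop :=
  if s is (f, a, b) :: s' then
    [/\ holomorphic_disc f, disc a, disc b, f a = p & disc_chain (f b) q s']
  else p = q.

Definition kobayashi (R : realType) (M : complexManifold R) (p q : M) : \bar R :=
  ereal_inf [set (\sum_(l <- s) (poincare_dist l.1.2 l.2)%:E)%E |
              s in disc_chain p q].

(* The other axioms of a distance always hold for [kobayashi], finiteness being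
   due to the connectedness of M.                                             *)
Definition hyperbolic (R : realType) (M : complexManifold R) : Prop :=
  forall p q : M, kobayashi p q = 0%E -> p = q.

Definition closed_curve (R : realType) (T : topologicalType) (a b : R)
    (gamma : R -> T) : Prop :=
  {within `[a, b], continuous gamma} /\ gamma a = gamma b.

Definition freely_homotopic (R : realType) (T : topologicalType) (a b : R)
    (gamma0 gamma1 : R -> T) : Prop :=
  exists H : R * R -> T,
    [/\ {within `[a, b] `*` `[0, 1], continuous H},
        forall t, t \in `[a, b] -> H (t, 0) = gamma0 t,
        forall t, t \in `[a, b] -> H (t, 1) = gamma1 t
      & forall s, s \in `[0, 1] -> H (a, s) = H (b, s)].

Definition null_homotopic (R : realType) (T : topologicalType) (a b : R)
    (gamma : R -> T) : Prop :=
  exists x : T, freely_homotopic a b gamma (cst x).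

(* The set X with the topology whose open sets are the unions of rho-balls.  The
   definition makes sense for any rho, but is meant for distances.            *)
Definition metric_carrier (R : realType) (X : choiceType)
  (rho : X -> X -> \bar R) : Type := X.

Section metric_topology.
Variables (R : realType) (X : choiceType) (rho : X -> X -> \bar R).

HB.instance Definition _ := Choice.on (metric_carrier rho).

Definition metric_open (U : set (metric_carrier rho)) : Prop :=
  forall x : X, U x ->
    exists2 e : R, 0 < e & [set y : X | (rho x y < e%:E)%E] `<=` U.

Lemma metric_openT : metric_open setT.
Proof. by move=> x _; exists 1. Qed.

Lemma metric_openI (A B : set (metric_carrier rho)) :
  metric_open A -> metric_open B -> metric_open (A `&` B).
Proof.
move=> oA oB x [/oA[e e0 eA] /oB[d d0 dB]].
exists (Num.min e d); first by rewrite lt_min e0.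
move=> y /= xy; split.
  by apply: eA => /=; apply: (lt_le_trans xy); rewrite lee_fin ge_min lexx.
by apply: dB => /=; apply: (lt_le_trans xy); rewrite lee_fin ge_min lexx orbT.
Qed.

Lemma metric_open_bigU (I : Type) (F : I -> set (metric_carrier rho)) :
  (forall i, metric_open (F i)) -> metric_open (\bigcup_i F i).
Proof.
move=> oF x [i _ /oF[e e0 eF]]; exists e => // y /eF Fy.
by exists i.
Qed.

HB.instance Definition _ := isOpenTopological.Build (metric_carrier rho)
  metric_openT metric_openI metric_open_bigU.

End metric_topology.

Definition curve_length (R : realType) (X : Type) (rho : X -> X -> \bar R)
    (a b : R) (alpha : R -> X) : \bar R :=
  ereal_sup [set (let t := nth b (a :: s) in
                  \sum_(0 <= k < size s) rho (alpha (t k)) (alpha (t k.+1)))%E |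
              s in itv_partition a b].

(* The l_1-invariant of the metric space (X, rho). *)
Definition ell1 (R : realType) (X : choiceType) (rho : X -> X -> \bar R) :
    \bar R :=
  ereal_inf [set l | exists (a b : R) (alpha : R -> metric_carrier rho),
    [/\ a < b, closed_curve a b alpha, (curve_length rho a b alpha < +oo)%E,
        ~ null_homotopic a b alpha & l = curve_length rho a b alpha]].

(* Main.v *)
Require Import Defs.
From mathcomp Require Import all_boot all_order all_algebra.
From mathcomp Require Import all_classical all_reals all_analysis.
From mathcomp Require Import complex ring lra.
Set Implicit Arguments.
Unset Strict Implicit.
Unset Printing Implicit Defensive.
Import Order.TTheory GRing.Theory Num.Theory numFieldNormedType.Exports.
Local Open Scope classical_set_scope.
Local Open Scope ring_scope.
Local Open Scope complex_scope.

(** A holomorphic map sends discs to discs, hence does not increase the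
    Kobayashi distance [kobayashi_nonexpansive]: it sends a rectifiable loop to
    a loop that is at most as long.  Call a loop essential if it is not freely
    homotopic to a constant; the inequality follows as soon as the image of an
    essential loop is essential.

    The hypothesis on [f] speaks of the manifold topologies, whereas the loops
    and homotopies of [ell1] are continuous for the Kobayashi distances; so the
    two topologies must be compared, in two directions.

    The manifold topology is always the finer one [kobayashi_near]: in a chart,
    points near [p] lie on a complex line through [p], on a disc whose centre
    is [p] and whose radius does not depend on the point; as the point tends to
    [p], its parameter in that disc tends to the centre.

    On a hyperbolic manifold the Kobayashi distance gives back the manifold
    topology, which is a theorem of Barth [kobayashi_ball_subset].  Let K be a
    compact neighbourhood of p.  Its boundary is compact and does not contain p;
    by hyperbolicity and the continuity of the distance, the points of the
    boundary are at distance at least e > 0 from p.  A chain of discs from p to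
    a point outside of K traces a path, which crosses the boundary, and the
    chain can be stopped at the crossing without becoming longer
    [disc_chain_boundary]; hence the ball of radius e about p lies in K.

    An essential loop for the distance of M1 is therefore a loop of the manifold
    M1, by Barth's theorem, and it is essential there, as a homotopy in the
    manifold is one for the distance; its image is essential in the manifold M2
    by hypothesis, hence for the distance of M2, by Barth's theorem again. *)

(** * Differentiability is local *)

Lemma near_eq_differentiable (K : numFieldType) (V W : normedModType K)
    (f g : V -> W) (x : V) :
  {near x, f =1 g} -> differentiable f x -> differentiable g x.
Proof.
move=> fg df; have fgx : f x = g x := nbhs_singleton fg.
have gE : g \o shift x = cst (g x) + 'd f x +o_ 0 id.
  apply/eqaddoP => e e0; have /eqaddoP/(_ e e0) := diff_locally df.
  apply: filter_app.
  have : \forall y \near 0, f (y + x) = g (y + x).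
    have : (shift x @ nbhs 0) [set y | f y = g y].
      rewrite -[shift x]/(id \o shift x) cvg_comp_shift add0r; exact: fg.
    by [].
  apply: filterS => y /= fgy.
  by rewrite !fctE /= fgy fgx.
have dgE := diff_unique (diff_continuous df) gE.
by apply/diff_locallyP; rewrite dgE; split=> //; exact: diff_continuous.
Qed.

(** * The Poincare distance of the disc *)

Lemma discE (R : realType) (z : R[i]) :
  disc z = (complex.Re z ^+ 2 + complex.Im z ^+ 2 < 1) :> Prop.
Proof.
rewrite /disc /= normc_def -[1 in LHS]/((1 : R)%:C) ltcR.
rewrite -[X in _ < X]sqrtr1 ltr_sqrt//.
Qed.

Lemma normc_le (R : realType) (z w : R[i]) :
  (Normc.normc z <= Normc.normc w) =
  (complex.Re z ^+ 2 + complex.Im z ^+ 2 <=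
   complex.Re w ^+ 2 + complex.Im w ^+ 2).
Proof.
by case: z w => [x y] [u v] /=; rewrite ler_sqrt // addr_ge0 // sqr_ge0.
Qed.

Lemma normc_lt (R : realType) (z w : R[i]) :
  (Normc.normc z < Normc.normc w) =
  (complex.Re z ^+ 2 + complex.Im z ^+ 2 <
   complex.Re w ^+ 2 + complex.Im w ^+ 2).
Proof. by rewrite !ltNge normc_le. Qed.

Lemma normc_ge0 (R : realType) (z : R[i]) : 0 <= Normc.normc z.
Proof. by case: z => x y; exact: sqrtr_ge0. Qed.

(** Because |1 - a^* b|^2 - |a - b|^2 = (1 - |a|^2) (1 - |b|^2). *)
Lemma normc_moebius_lt (R : realType) (a b : R[i]) : disc a -> disc b ->
  Normc.normc (a - b) < Normc.normc (1 - a^* * b).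
Proof.
rewrite normc_lt !discE; case: a b => [x y] [u v] /= h k.
have : 0 < (1 - (x ^+ 2 + y ^+ 2)) * (1 - (u ^+ 2 + v ^+ 2)).
  by apply: mulr_gt0; rewrite subr_gt0.
by lra.
Qed.

Lemma poincare_dist_ge0 (R : realType) (a b : R[i]) : 0 <= poincare_dist a b.
Proof.
rewrite /poincare_dist; set t := Normc.normc _.
have t0 : 0 <= t := normc_ge0 _.
have [t1|t1] := ltP t 1; last first.
  (* Outside of the disc: [ln] is 0 where its argument is not positive. *)
  by rewrite ln0 // mulr_ge0_le0 ?addr_ge0 // invr_le0 subr_le0.
by apply: ln_ge0; rewrite ler_pdivlMr ?subr_gt0 // mul1r; lra.
Qed.

(** Poincare discs about [a] are Euclidean discs, hence convex.  In formulas,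
    the point c at time t of the segment has |a - c| = t |a - b|, and
    1 - a^* c = (1 - t) (1 - |a|^2) + t (1 - a^* b) is at least t |1 - a^* b| in
    modulus, since both terms have a nonnegative real part and the first is
    real. *)
Lemma poincare_dist_segment (R : realType) (a b : R[i]) (t : R) :
  disc a -> disc b -> 0 <= t <= 1 ->
  poincare_dist a (a + t%:C * (b - a)) <= poincare_dist a b.
Proof.
move=> da db /andP[t0 t1]; rewrite /poincare_dist; set c := a + t%:C * _.
have lt1 := normc_moebius_lt da db.
have b0 : 0 < Normc.normc (1 - a^* * b) := le_lt_trans (normc_ge0 _) lt1.
set u := Normc.normc _; set v := Normc.normc _.
have u0 : 0 <= u := normc_ge0 _.
have v1 : v < 1.
  by rewrite /v Normc.normcM Normc.normcV ltr_pdivrMr // mul1r.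
suff uv : u <= v.
  have u1 : u < 1 := le_lt_trans uv v1.
  rewrite ler_ln ?posrE ?divr_gt0 ?subr_gt0 ?ltr_pwDl //; last first.
    exact: le_trans uv.
  rewrite ler_pM ?addr_ge0 ?invr_ge0 ?subr_ge0 ?lerD2l //; first exact: ltW.
  by rewrite lef_pV2 ?posrE ?subr_gt0 // lerD2l lerN2.
have tb_c : Normc.normc (t%:C * (1 - a^* * b)) <= Normc.normc (1 - a^* * c).
  rewrite /c normc_le; move: da db; rewrite !discE {lt1 b0 u u0 v v1 c}.
  case: a b => [x y] [u v] /= da db.
  set A := 1 - (x ^+ 2 + y ^+ 2); set B := 1 - (x * u + y * v).
  have A0 : 0 <= A by rewrite subr_ge0 ltW.
  have B0 : 0 <= B.
    have : 0 <= (x - u) ^+ 2 + (y - v) ^+ 2 by rewrite addr_ge0 ?sqr_ge0.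
    by rewrite /B; lra.
  rewrite -subr_ge0.
  set d := _ - _.
  have {d}-> : d = ((1 - t) * A) ^+ 2 + 2 * (t * (1 - t) * (A * B)).
    by rewrite /d /A /B; ring.
  have t1' : 0 <= 1 - t by rewrite subr_ge0.
  by rewrite addr_ge0 ?sqr_ge0 // !mulr_ge0.
have [c0|c0] := eqVneq (1 - a^* * c) 0.
  by rewrite /u c0 invr0 mulr0 Normc.normc0 normc_ge0.
rewrite /u /v !Normc.normcM !Normc.normcV ler_pdivrMr; last first.
  rewrite lt_neqAle normc_ge0 andbT eq_sym; apply: contra_neq c0.
  exact: Normc.eq0_normc.
rewrite mulrAC ler_pdivlMr //.
have -> : a - c = t%:C * (a - b) by rewrite /c; ring.
move: tb_c; rewrite !Normc.normcM => tb_c.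
by rewrite mulrAC [leRHS]mulrC ler_wpM2r ?normc_ge0.
Qed.

Lemma poincare_dist0_lt (R : realType) (e : R) : 0 < e ->
  exists2 a : R, 0 < a < 1 &
    poincare_dist 0 a%:C < e /\ poincare_dist a%:C 0 < e.
Proof.
move=> e0; pose E := expR (e / 2).
have E1 : 1 < E by rewrite expR_gt1 divr_gt0.
(* The solution of ln ((1 + a) / (1 - a)) = e / 2. *)
exists ((E - 1) / (E + 1)).
  apply/andP; split; first by rewrite divr_gt0//; lra.
  by rewrite ltr_pdivrMr; lra.
set a := _ / _.
have a0 : 0 < a by rewrite divr_gt0//; lra.
have aE : ln ((1 + a) / (1 - a)) = e / 2.
  have -> : (1 + a) / (1 - a) = E by rewrite /a; field; rewrite ?gt_eqF//; lra.
  by rewrite expRK.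
have d1 : poincare_dist 0 a%:C = e / 2.
  rewrite /poincare_dist -aE; congr (ln ((1 + _) / (1 - _)));
    by rewrite rmorph0 mul0r subr0 divr1 /= !sub0r sqrrN oppr0 expr0n addr0
      sqrtr_sqr gtr0_norm.
have d2 : poincare_dist a%:C 0 = e / 2.
  rewrite /poincare_dist -aE; congr (ln ((1 + _) / (1 - _)));
    by rewrite mulr0 !subr0 divr1 /= expr0n addr0 sqrtr_sqr gtr0_norm.
rewrite d1 d2; lra.
Qed.

(** * Charts and holomorphic discs *)

Section charts.
Variables (R : realType) (M : complexManifold R).
Implicit Types (c : chart R M (cm_dim M)) (p : M).

Lemma cmap_at c p : cdom c p -> {for p, continuous (cmap c)}.
Proof. by move=> cp; apply: cmap_continuous; rewrite inE. Qed.

Lemma cinv_at c (z : Cn R (cm_dim M)) : (cmap c @` cdom c) z ->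
  {for z, continuous (cinv c)}.
Proof. by move=> cz; apply: cinv_continuous; rewrite inE. Qed.

Lemma cmapK_at c p : cdom c p -> cinv c (cmap c p) = p.
Proof. by move=> cp; apply: cmapK; rewrite inE. Qed.

Lemma cdom_nbhs c p : cdom c p -> nbhs p (cdom c).
Proof. by move=> cp; apply: open_nbhs_nbhs; split => //; exact: cdom_open. Qed.

Lemma cmap_nbhs c p : cdom c p -> nbhs (cmap c p) (cmap c @` cdom c).
Proof.
move=> cp; apply: open_nbhs_nbhs; split; first exact: cmap_open.
by exists p.
Qed.

End charts.

Lemma holomorphic_disc_comp (R : realType) (M1 M2 : complexManifold R)
    (f : M1 -> M2) (g : R[i]^o -> M1) :
  holomorphic f -> holomorphic_disc g -> holomorphic_disc (f \o g).
Proof.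
move=> [fc fh] gh z dz; have [gc gd] := gh z dz; split.
  by apply: continuous_comp => //; exact: fc.
move=> c2 ac2 c2z; have [c1 ac1 c1z] := cm_cover (g z).
have gz := gd _ ac1 c1z.
apply: (@near_eq_differentiable _ _ _
  ((cmap c2 \o f \o cinv c1) \o (cmap c1 \o g))).
  have c1g : \forall w \near z, cdom c1 (g w) := gc _ (cdom_nbhs c1z).
  rewrite /prop_near1; apply: filterS c1g => w c1w.
  by rewrite /= cmapK_at.
by apply: differentiable_comp => //; exact: fh.
Qed.

(** Complex lines in a chart are holomorphic discs. *)
Lemma holomorphic_disc_chart (R : realType) (M : complexManifold R)
    (c : chart R M (cm_dim M)) (z0 v : Cn R (cm_dim M)) : cm_atlas c ->
  (forall z, disc z -> (cmap c @` cdom c) (z0 + z *: v)) ->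
  holomorphic_disc (fun z : R[i]^o => cinv c (z0 + z *: v)).
Proof.
move=> ac zv z dz.
have lin : differentiable (fun w : R[i]^o => z0 + w *: v) z.
  rewrite -[X in differentiable X _]/(cst z0 + (fun w : R[i]^o => w *: v)).
  apply: (@differentiableD _ _ _ (cst z0)); first exact: differentiable_cst.
  exact: (@differentiableZl _ _ _ (fun w : R[i]^o => w) v z).
split.
  apply: (@continuous_comp _ _ _ (fun w : R[i]^o => z0 + w *: v) (cinv c)).
    exact: differentiable_continuous lin.
  by apply: cinv_at; exact: zv.
move=> c' ac' c'z; have [p cp pE] := zv z dz.
apply: (differentiable_comp (g := cmap c' \o cinv c) lin).
rewrite -pE; apply: cm_compatible => //.
by move: c'z; rewrite -pE cmapK_at.
Qed.

(** * The Kobayashi pseudodistance *)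

Definition chain_length (R : realType) (M : complexManifold R)
    (s : seq ((R[i]^o -> M) * R[i] * R[i])) : \bar R :=
  (\sum_(l <- s) (poincare_dist l.1.2 l.2)%:E)%E.

Section kobayashi_theory.
Variables (R : realType) (M : complexManifold R).
Implicit Types (p q : M).

Lemma chain_length_ge0 (s : seq ((R[i]^o -> M) * R[i] * R[i])) :
  (0 <= chain_length s)%E.
Proof. by apply: sume_ge0 => l _; rewrite lee_fin poincare_dist_ge0. Qed.

Lemma kobayashi_le p q s : disc_chain p q s ->
  (kobayashi p q <= chain_length s)%E.
Proof. by move=> ?; apply: ereal_inf_lbound; exists s. Qed.

Lemma kobayashi_lt p q (u : \bar R) : (kobayashi p q < u)%E ->
  exists2 s, disc_chain p q s & (chain_length s < u)%E.
Proof. by move=> /ereal_inf_lt[_ [s ps <-] su]; exists s. Qed.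

Lemma kobayashi_ge0 p q : (0 <= kobayashi p q)%E.
Proof. by apply: le_ereal_inf_tmp => _ [s _ <-]; exact: chain_length_ge0. Qed.

Lemma disc_chain_cat p q r s s' :
  disc_chain p q s -> disc_chain q r s' -> disc_chain p r (s ++ s').
Proof.
elim: s p => [p -> //|[[g a] b] s IH p /= [gh da db ga sq] qr].
by split=> //; exact: IH.
Qed.

(** Strict bounds are witnessed by chains, which can be concatenated. *)
Lemma kobayashi_triangle p q r (u v : R) :
  (kobayashi p q < u%:E)%E -> (kobayashi q r < v%:E)%E ->
  (kobayashi p r < (u + v)%:E)%E.
Proof.
move=> /kobayashi_lt[s ps su] /kobayashi_lt[s' ps' sv].
apply: (le_lt_trans (kobayashi_le (disc_chain_cat ps ps'))).
by rewrite /chain_length big_cat EFinD lteD.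
Qed.

Lemma kobayashi_disc (g : R[i]^o -> M) (a b : R[i]) : holomorphic_disc g ->
  disc a -> disc b -> (kobayashi (g a) (g b) <= (poincare_dist a b)%:E)%E.
Proof.
move=> gh da db.
have -> : (poincare_dist a b)%:E = chain_length [:: (g, a, b)].
  by rewrite /chain_length big_seq1.
exact: kobayashi_le.
Qed.

(** Fix [a] in the disc, not 0, at Poincare distance less than [e] from 0.  If a
    ball of radius [r] about [p] lies in a chart, then a point [q] at distance
    less than [a * r] from [p] is the value at [a] of a line through [p] that
    maps the unit disc into that ball. *)
Lemma kobayashi_near p (e : R) : 0 < e ->
  \forall q \near p, (kobayashi p q < e%:E)%E /\ (kobayashi q p < e%:E)%E.
Proof.
move=> /poincare_dist0_lt[a /andP[a0 a1] [ae1 ae2]].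
have [c ac cp] := cm_cover p.
have /nbhs_ballP[r /= r0 rc] := cmap_nbhs cp.
have aC0 : 0 < a%:C by rewrite ltcR.
have ar0 : 0 < a%:C * r by rewrite mulr_gt0.
have near_c : \forall q \near p, `|cmap c p - cmap c q| < a%:C * r.
  have /cvgr_dist_lt := cmap_at cp; exact.
move: near_c (cdom_nbhs cp); apply: filterS2 => q pq cq.
pose v : Cn R (cm_dim M) := a%:C^-1 *: (cmap c q - cmap c p).
have vr : `|v| < r.
  rewrite normrZ normfV (gtr0_norm aC0) distrC.
  by rewrite ltr_pdivrMl.
pose g (z : R[i]^o) := cinv c (cmap c p + z *: v).
have gh : holomorphic_disc g.
  apply: holomorphic_disc_chart => // z dz; apply: rc.
  rewrite -ball_normE /= opprD addNKr normrN normrZ.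
  apply: le_lt_trans vr; rewrite ler_piMl //.
  exact: ltW.
have g0 : g 0 = p by rewrite /g scale0r addr0 cmapK_at.
have ga : g a%:C = q.
  by rewrite /g scalerA mulfV ?gt_eqF// scale1r subrKC cmapK_at.
have d0 : disc (0 : R[i]) by rewrite /disc /= normr0.
have da : disc a%:C by rewrite /disc /= (gtr0_norm aC0) ltcR.
split.
  rewrite -g0 -ga; apply: le_lt_trans (kobayashi_disc gh d0 da) _.
  by rewrite lte_fin.
rewrite -g0 -ga; apply: le_lt_trans (kobayashi_disc gh da d0) _.
by rewrite lte_fin.
Qed.

End kobayashi_theory.

Lemma kobayashi_nonexpansive (R : realType) (M1 M2 : complexManifold R)
    (f : M1 -> M2) (hf : holomorphic f) (p q : M1) :
  (kobayashi (f p) (f q) <= kobayashi p q)%E.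
Proof.
apply: le_ereal_inf_tmp => _ [s ps <-].
pose F (l : (R[i]^o -> M1) * R[i] * R[i]) := (f \o l.1.1, l.1.2, l.2).
have -> : (\sum_(l <- s) (poincare_dist l.1.2 l.2)%:E)%E =
    chain_length (map F s).
  by rewrite /chain_length big_map.
apply: kobayashi_le.
elim: s p ps => [p /= -> //|[[g a] b] s IH p /= [gh da db <- sq]].
by split => //; [exact: holomorphic_disc_comp|exact: IH].
Qed.

(** * Compact neighbourhoods *)

Lemma real_complex_continuous (R : realType) :
  continuous (fun x : R => x%:C : R[i]^o).
Proof.
move=> x; apply/(@cvgrPdist_lt R[i] R[i]^o) => e; case: e => [r s].
rewrite ltcE /= => /andP[/eqP -> r0].
near=> y.
rewrite -rmorphB /= normc_def /= expr0n addr0 sqrtr_sqr ltcR.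
by near: y; apply: cvgr_dist_lt.
Unshelve. all: by end_near. Qed.

Lemma compact_square (R : realType) (a b c d : R) :
  compact [set w : R[i]^o | a <= complex.Re w <= b /\ c <= complex.Im w <= d].
Proof.
pose g (xy : R * R) : R[i]^o := xy.1%:C + 'i * xy.2%:C.
have gc : continuous g.
  move=> xy; apply: cvgD; last apply: cvgMr.
    by apply: continuous_comp; [exact: cvg_fst|exact: real_complex_continuous].
  by apply: continuous_comp; [exact: cvg_snd|exact: real_complex_continuous].
rewrite (_ : mkset _ = g @` (`[a, b] `*` `[c, d])).
  apply: continuous_compact; first exact: continuous_subspaceT.
  by apply: compact_setX; exact: segment_compact.
apply/seteqP; split => [[x y] /= [xab ycd]|_ [[x y] /= [xab ycd] <-]].
  by exists (x, y); rewrite /= ?in_itv //= /g [RHS]complexE.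
move: xab ycd.
by rewrite !in_itv /= !(mul0r, mul1r, mulr0, subr0, addr0, add0r).
Qed.

Lemma normc_le_coord (R : realType) (w : R[i]) (e : R) : `|w| <= e%:C ->
  `|complex.Re w| <= e /\ `|complex.Im w| <= e.
Proof.
rewrite normc_def lecR => we.
split; apply: le_trans we; rewrite -sqrtr_sqr ler_wsqrtr //.
  by rewrite lerDl sqr_ge0.
by rewrite lerDr sqr_ge0.
Qed.

Lemma normc_lt_coord (R : realType) (w : R[i]) (e r : R) :
  `|complex.Re w| <= e -> `|complex.Im w| <= e -> e + e < r -> `|w| < r%:C.
Proof.
move=> re im er; have e0 : 0 <= e := le_trans (normr_ge0 _) re.
have r0 : 0 < r by lra.
rewrite normc_def ltcR -[r]gtr0_norm // -sqrtr_sqr ltr_sqrt ?exprn_gt0 //.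
rewrite -(real_normK (num_real (complex.Re w))).
rewrite -(real_normK (num_real (complex.Im w))).
have := normr_ge0 (complex.Re w); have := normr_ge0 (complex.Im w); nra.
Qed.

Lemma Cn_compact_nbhs (R : realType) n (z : Cn R n) (W : set (Cn R n)) :
  nbhs z W -> exists K, [/\ compact K, nbhs z K & K `<=` W].
Proof.
move=> /nbhs_ballP[[r s]]; rewrite /= ltcE /= => /andP[/eqP -> r0] rW.
(* A square with half-side [e] lies within [2 * e] of its centre. *)
pose e := r / 3.
have e0 : 0 < e by rewrite divr_gt0.
pose Q (w : R[i]) : set R[i]^o := [set u |
  complex.Re w - e <= complex.Re u <= complex.Re w + e /\
  complex.Im w - e <= complex.Im u <= complex.Im w + e].
exists [set v : Cn R n | forall i, Q (z ord0 i) (v ord0 i)]; split.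
- have := @rV_compact R[i]^o n (fun i => Q (z ord0 i)).
  by apply=> i; exact: compact_square.
- have eC0 : 0 < e%:C by rewrite ltcR.
  apply: filterS (@nbhsx_ballx _ (Cn R n) z _ eC0) => v [_ zv] i.
  have := zv ord0 i; rewrite -ball_normE /=.
  by move=> /ltW/normc_le_coord; rewrite !raddfB /= !ler_distlC.
- move=> v Qv; apply: rW; split=> [|i j]; first by rewrite ltcR.
  rewrite ord1 -ball_normE /=.
  have [] := Qv j.
  rewrite -!ler_distlC -!raddfB => re im.
  have r3 : r = e + e + e by rewrite /e; field.
  by apply: normc_lt_coord re im _; rewrite r3; lra.
Qed.

Lemma manifold_compact_nbhs (R : realType) (M : complexManifold R) (p : M)
    (U : set M) :
  nbhs p U -> exists K, [/\ compact K, nbhs p K & K `<=` U].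
Proof.
move=> pU; have [c ac cp] := cm_cover p.
have cz : (cmap c @` cdom c) (cmap c p) by exists p.
have : nbhs (cmap c p) (cinv c @^-1` U).
  by apply: (cinv_at cz); rewrite cmapK_at.
move=> /(filterI (cmap_nbhs cp))/Cn_compact_nbhs[K [Kc Kp KU]].
exists (cinv c @` K); split.
- apply: continuous_compact => //; apply: continuous_in_subspaceT => z.
  by rewrite inE => /KU[+ _]; exact: cinv_at.
- have := cmap_at cp Kp; move: (cdom_nbhs cp); apply: filterS2 => q cq Kq.
  by exists (cmap c q) => //; rewrite cmapK_at.
- by move=> _ [z /KU[_ Uz] <-].
Qed.

(** * Small Kobayashi balls are small in the manifold *)

Lemma disc_segment (R : realType) (a b : R[i]) (t : R) :
  disc a -> disc b -> 0 <= t <= 1 -> disc (a + t%:C * (b - a)).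
Proof.
move=> da db /andP[t0 t1]; rewrite /disc /=.
have -> : a + t%:C * (b - a) = (1 - t)%:C * a + t%:C * b.
  by rewrite rmorphB rmorph1; ring.
have normE (z : R[i]) : `|z| = (Normc.normc z)%:C by [].
move: da db; rewrite /disc /= !normE !ltcR => a1 b1.
apply: le_lt_trans (le_normcD _ _) _; rewrite !Normc.normcM.
have normcR (x : R) : 0 <= x -> Normc.normc x%:C = x.
  by move=> x0; rewrite /= expr0n addr0 sqrtr_sqr ger0_norm.
rewrite !normcR ?subr_ge0 //.
have [->|t_gt0] := eqVneq t 0; first by rewrite subr0 mul1r mul0r addr0.
have {}t_gt0 : 0 < t by rewrite lt_def t_gt0.
by nra.
Qed.

Section barth.
Variables (R : realType) (M : complexManifold R).

(** In the first disc of the chain that does not end in the interior of [K], the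
    image of the segment from its first point to its second is connected, starts
    in the interior and leaves it; if it avoided the boundary, its part in the
    interior, being its part in the closed set [K], would be open and closed.
    The chain is cut where the segment meets the boundary, and
    [poincare_dist_segment] bounds the length of the last link. *)
Lemma disc_chain_boundary (K : set M) (p q : M) s :
  compact K -> K° p -> ~ K° q -> disc_chain p q s ->
  exists y s', [/\ (K `\` K°) y, disc_chain p y s' &
    (chain_length s' <= chain_length s)%E].
Proof.
move=> Kc; have Kcl : closed K by apply: compact_closed Kc; exact: cm_hausdorff.
elim: s p => [p Kp + /= pq|[[g a] b] s IH p Kp Kq /= [gh da db ga sq]].
  by rewrite -pq.
have [Kgb|Kgb] := pselect (K° (g b)).
  have [y [s' [Ky gy ss']]] := IH _ Kgb Kq sq.
  exists y, ((g, a, b) :: s'); split => //.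
  by rewrite /chain_length !big_cons leeD2l.
pose h (t : R) := a + t%:C * (b - a).
have h0 : h 0 = a by rewrite /h rmorph0 mul0r addr0.
have h1 : h 1 = b by rewrite /h rmorph1 mul1r subrKC.
have hc : continuous (h : R -> R[i]^o).
  move=> t; apply: cvgD; first exact: cvg_cst.
  by apply: cvgMl; exact: real_complex_continuous.
have dh t : t \in `[0, 1] -> disc (h t).
  by rewrite in_itv; exact: disc_segment.
have ghc : {within `[0, 1], continuous (g \o h)}.
  apply: continuous_in_subspaceT => t; rewrite inE /= => t01.
  by apply: continuous_comp; [exact: hc|exact: (gh _ (dh t t01)).1].
have Ih :=
  connected_continuous_connected (segment_connected (a := 0) (b := 1)) ghc.
have [[_ [[t t01 <-] Kt]]|noK] :=
    pselect (((g \o h) @` `[0, 1]) `&` (K `\` K°) !=set0).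
  exists (g (h t)), [:: (g, a, h t)]; split => //=.
    by split => //; exact: dh.
  rewrite /chain_length big_cons big_nil adde0 big_cons /=.
  apply: (@le_trans _ _ (poincare_dist a b)%:E).
    by rewrite lee_fin poincare_dist_segment.
  by rewrite leeDl //; exact: chain_length_ge0.
exfalso; apply: Kgb.
have KE : (g \o h) @` `[0, 1] `&` K° = (g \o h) @` `[0, 1].
  apply: Ih.
  - exists p; split; last by [].
    by exists 0; rewrite /= ?h0 // in_itv /= lexx ler01.
  - by exists K° => //; exact: open_interior.
  - exists K => //; apply/seteqP; split => y [Iy Ky]; split => //.
      exact: interior_subset.
    by apply: contrapT => nKy; apply: noK; exists y.
have : ((g \o h) @` `[0, 1]) (g b).
  by exists 1; rewrite /= ?h1 // in_itv /= lexx ler01.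
by rewrite -KE => -[].
Qed.

Hypothesis hM : hyperbolic M.

(** The distance to [p] is positive on [S] and, by the triangle inequality and
    [kobayashi_near], locally bounded below by a positive constant. *)
Lemma kobayashi_compact_ge (p : M) (S : set M) : compact S -> ~ S p ->
  exists2 e : R, 0 < e & forall y, S y -> (e%:E <= kobayashi p y)%E.
Proof.
move=> /compact_near_coveringP Sc Sp.
have : \forall e \near 0^'+, S `<=` (fun y => (e%:E <= kobayashi p y)%E).
  apply: Sc => y Sy.
  have py0 : (0 < kobayashi p y)%E.
    rewrite lt_def kobayashi_ge0 andbT; apply/eqP => /hM py.
    by apply: Sp; rewrite py.
  have [r r0 ry] : exists2 r : R, 0 < r & (r%:E <= kobayashi p y)%E.
    case: (kobayashi p y) py0 => [r r0||] //; first by exists r.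
    by exists 1; rewrite ?leey.
  have r20 : 0 < r / 2 by rewrite divr_gt0.
  near=> z e.
    rewrite leNgt; apply/negP => pz.
    have er : e < r / 2 by near: e; exact: nbhs_right_lt.
    have zy : (kobayashi z y < (r / 2)%:E)%E.
      by near: z; apply: filterS (kobayashi_near y r20) => w [].
    have := kobayashi_triangle (lt_trans pz (er : (e%:E < (r / 2)%:E)%E)) zy.
    by rewrite -splitr ltNge ry.
move=> near_e; near (0 : R)^'+ => e; exists e.
  by near: e; exact: nbhs_right_gt.
by near: e.
Unshelve. all: by end_near. Qed.

(** This is Barth's theorem.  The radius is a lower bound of the distance from
    [p] to the boundary of a compact neighbourhood [K]: a chain from [p] to a
    point outside of [K] is at least as long as its part up to the boundary. *)
Lemma kobayashi_ball_subset (p : M) (U : set M) : nbhs p U ->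
  exists2 e : R, 0 < e & [set q | (kobayashi p q < e%:E)%E] `<=` U.
Proof.
move=> /manifold_compact_nbhs[K [Kc Kp KU]].
have Kcl : closed K by apply: compact_closed Kc; exact: cm_hausdorff.
have Sc : compact (K `\` K°).
  rewrite setDE; apply: compact_closedI => //.
  by apply: open_closedC; exact: open_interior.
have [e e0 eS] := kobayashi_compact_ge Sc (fun Sp => Sp.2 Kp).
exists e => // q /= /kobayashi_lt[s ps se]; apply: KU.
apply: interior_subset.
apply: contrapT => nKq.
have [y [s' [Sy py ss']]] := disc_chain_boundary Kc Kp nKq ps.
have := le_lt_trans (le_trans (kobayashi_le py) ss') se.
by rewrite ltNge eS.
Qed.

End barth.

(** * Comparison of the loops of two spaces *)

Section change_of_space.
Variables (R : realType) (T U : topologicalType) (g : T -> U).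
Hypothesis gc : continuous g.
Variables (a b : R) (gamma : R -> T).

Lemma closed_curve_comp :
  closed_curve a b gamma -> closed_curve a b (g \o gamma).
Proof.
move=> [gammac gammaab]; split; last by rewrite /= gammaab.
by apply: within_continuous_comp => // x _; exact: gc.
Qed.

Lemma null_homotopic_comp :
  null_homotopic a b gamma -> null_homotopic a b (g \o gamma).
Proof.
move=> [x [H [Hc H0 H1 Hab]]]; exists (g x), (g \o H); split.
- by apply: within_continuous_comp => // y _; exact: gc.
- by move=> t /H0 /= ->.
- by move=> t /H1 /= ->.
- by move=> s /Hab /= ->.
Qed.

End change_of_space.

Section kobayashi_topology.
Variables (R : realType) (M : complexManifold R).

Lemma to_kobayashi_continuous :
  continuous (fun p : M => p : metric_carrier (@kobayashi R M)).
Proof.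
apply/continuousP => U oU; rewrite openE => p Up.
have [e e0 eU] := oU p Up.
by apply: filterS (kobayashi_near p e0) => q [pq _]; exact: eU.
Qed.

Lemma of_kobayashi_continuous : hyperbolic M ->
  continuous (fun p : metric_carrier (@kobayashi R M) => p : M).
Proof.
move=> hM; apply/continuousP => U oU.
rewrite -[open _]/(metric_open (U : set (metric_carrier (@kobayashi R M)))).
move=> p Up; by apply: kobayashi_ball_subset => //; exact: open_nbhs_nbhs.
Qed.

End kobayashi_topology.

Lemma nonexpansive_continuous (R : realType) (X Y : choiceType)
    (dX : X -> X -> \bar R) (dY : Y -> Y -> \bar R) (f : X -> Y) :
  (forall p q, (dY (f p) (f q) <= dX p q)%E) ->
  continuous (f : metric_carrier dX -> metric_carrier dY).
Proof.
move=> fle; apply/continuousP => U oU.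
rewrite -[open _]/(metric_open (f @^-1` U : set (metric_carrier dX))) => p Up.
have [e e0 eU] := oU (f p) Up; exists e => // q /= pq.
by apply: eU; exact: le_lt_trans (fle p q) pq.
Qed.

Lemma curve_length_nonexpansive (R : realType) (X Y : Type)
    (dX : X -> X -> \bar R) (dY : Y -> Y -> \bar R) (f : X -> Y)
    (a b : R) (alpha : R -> X) :
  (forall p q, (dY (f p) (f q) <= dX p q)%E) ->
  (curve_length dY a b (f \o alpha) <= curve_length dX a b alpha)%E.
Proof.
move=> fle; apply: ge_ereal_sup => _ [s sab <-].
apply: le_trans (ereal_sup_ubound _); last by exists s.
by apply: lee_sum => k _; exact: fle.
Qed.

Theorem theorem4p1 (R : realType) (M1 M2 : complexManifold R) (f : M1 -> M2)
    (hM1 : hyperbolic M1) (hM2 : hyperbolic M2) (hf : holomorphic f)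
    (f_inj : forall (a b : R) (gamma : R -> M1), a < b ->
       closed_curve a b gamma ->
       ~ null_homotopic a b gamma -> ~ null_homotopic a b (f \o gamma)) :
  (ell1 (@kobayashi R M2) <= ell1 (@kobayashi R M1))%E.
Proof.
have fle := kobayashi_nonexpansive hf.
apply: le_ereal_inf_tmp => _ [a [b [alpha [ab acl afin ann ->]]]].
have len := curve_length_nonexpansive a b alpha fle.
apply: le_trans len; apply: ereal_inf_lbound.
exists a, b, (f \o alpha); split => //.
- exact: (closed_curve_comp (nonexpansive_continuous fle)).
- exact: le_lt_trans (curve_length_nonexpansive a b alpha fle) afin.
- move=> /(null_homotopic_comp (of_kobayashi_continuous hM2)).
  apply: (f_inj a b alpha ab).
    exact: (closed_curve_comp (of_kobayashi_continuous hM1) acl).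
  by move=> /(null_homotopic_comp (@to_kobayashi_continuous R M1)).
Qed.
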